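(* If $G$ is a maximal outerplanar graph on $n \ge 3$ vertices, then $\operatorname{fd}(G) < 17n/19$.
   Context: A maximal outerplanar graph is a triangulation of a polygon (all vertices on the outer face and every bounded face a triangle). All graphs are finite and simple; $N(v)$ denotes the open neighborhood of $v$. For a graph $G=(V,E)$ and an integer $k \ge 1$, a $k$-fair dominating set is a dominating set $D \subseteq V$ such that $|N(v) \cap D| = k$ for every $v \in V \setminus D$ (the set $D = V$ qualifies vacuously). A fair dominating set (FD-set) is a set that is a $k$-fair dominating set for some $k \ge 1$. If $G$ has at least one edge, $\operatorname{fd}(G)$ is the minimum cardinality of an FD-set of $G$. *)

(* Defs.v *)
From mathcomp Require Import all_boot all_order all_algebra.

Set Implicit Arguments.
Unset Strict Implicit.
Unset Printing Implicit Defensive.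

(* A finite simple graph is a symmetric irreflexive relation on a finType. *)

Section FairDomination.
Variables (T : finType) (e : rel T).
Implicit Types (D : {set T}) (k : nat).

Definition neighborhood (v : T) : {set T} := [set u | e v u].

Definition dominating D : bool :=
  [forall v, (v \in D) || [exists u in D, e v u]].

Definition k_fair_dominating k D : bool :=
  dominating D && [forall v, (v \notin D) ==> (#|neighborhood v :&: D| == k)].

(* The bound k <= #|T| + 1 only serves to make the predicate boolean and loses
   no generality; see fd_setP. *)
Definition fd_set D : bool :=
  [exists k : 'I_#|T|.+2, (0 < k) && k_fair_dominating k D].

Lemma fd_setP D :
  reflect (exists2 k, 0 < k & k_fair_dominating k D) (fd_set D).
Proof.
apply: (iffP existsP) => [[k /andP[k0 kD]]|[k k0 /andP[domD /forallP kD]]].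
  by exists k.
have [/existsP[v vD]|] := boolP [exists v, v \notin D].
  have kT : k < #|T|.+2.
    by have /eqP <- := implyP (kD v) vD; rewrite ltnS (leq_trans (max_card _)).
  by exists (Ordinal kT); rewrite k0 /k_fair_dominating domD; apply/forallP.
rewrite negb_exists => /forallP allD; exists (Ordinal (isT : 1 < #|T|.+2)).
rewrite /k_fair_dominating domD; apply/forallP => v /=.
by apply/implyP => vD; case/negP: (allD v).
Qed.

Lemma fd_setT : fd_set setT.
Proof.
apply/fd_setP; exists 1 => //; apply/andP; split; apply/forallP => v.
  by rewrite inE.
by rewrite inE.
Qed.

Definition fd : nat := #|[arg min_(D < setT | fd_set D) #|D|]|.

Lemma fdP :
  (exists2 D, fd_set D & #|D| = fd) /\ (forall D, fd_set D -> fd <= #|D|).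
Proof.
by rewrite /fd; case: arg_minnP => [|D fdD minD]; [exact: fd_setT|split; first exists D].
Qed.

End FairDomination.

(* The sequence s lists the corners of a convex polygon in cyclic order, and
   edges are drawn as straight segments between corners. *)
Section PolygonTriangulation.
Variables (T : finType) (e : rel T) (s : seq T).

(* In convex position two segments cross iff their four distinct endpoints
   alternate along the polygon. *)
Definition non_crossing : Prop :=
  forall a b c d : T, subseq [:: a; b; c; d] s -> ~ (e a c /\ e b d).

(* When no two edges cross and the sides of the polygon are edges, the boundaries
   of the bounded faces are exactly the convex sub-polygons whose sides are edges
   and which have no edge drawn in their interior; since an edge meeting the
   interior cannot cross a side, it is a diagonal of the sub-polygon. *)
Definition bounded_face (c : seq T) : Prop :=
  [/\ subseq c s, 2 < size c, cycle e c
    & forall x y, x \in c -> y \in c -> e x y -> y = next c x \/ x = next c y].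

Definition polygon_triangulation : Prop :=
  [/\ uniq s /\ (forall x, x \in s),
      2 < size s /\ cycle e s,
      non_crossing
    & forall c, bounded_face c -> size c = 3].

End PolygonTriangulation.

Definition maximal_outerplanar (T : finType) (e : rel T) : Prop :=
  [/\ symmetric e, irreflexive e & exists s : seq T, polygon_triangulation e s].

(* Main.v *)
Require Import Defs.
From mathcomp Require Import all_boot all_order all_algebra.
From mathcomp Require Import zify.

(** An independent set of vertices of common degree k >= 1 is the complement of
    a k-fair dominating set.  Hence, if fd(G) >= 17n/19, every independent set
    whose vertices have the same degree has at most 2n/19 elements.  For n >= 5
    the vertices of degree 2 are independent, those of degree 3 induce disjoint
    paths along the outer cycle, and every induced subgraph has a vertex of
    degree at most 2; so there are at most 2n/19, 4n/19, 6n/19 and 6n/19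
    vertices of degree 2, 3, 4 and 5.  This forces the degree sum to be at least
    6n - (4*2 + 3*4 + 2*6 + 6)n/19 = 4n, whereas 2-degeneracy makes it smaller
    than 4n. *)

Set Implicit Arguments.
Unset Strict Implicit.
Unset Printing Implicit Defensive.

(** * Degeneracy, independent sets and fair domination *)

Section Degeneracy.
Variables (T : finType) (e : rel T).
Hypotheses (esym : symmetric e) (eirr : irreflexive e).
Implicit Types (A B I : {set T}) (k : nat).

Local Notation N := (neighborhood e).

Definition degree (v : T) : nat := #|N v|.

Definition independent I := {in I &, forall x y, ~~ e x y}.

(** This is [k]-degeneracy of the subgraph induced on [A]. Quantifying over all nonempty subsets
    makes it hereditary, as the inductions by vertex deletion require. *)
Definition degenerate k A := forall B, B \subset A -> B != set0 ->
  exists2 x, x \in B & #|N x :&: B| <= k.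

Lemma sub_degenerate k A B : B \subset A -> degenerate k A -> degenerate k B.
Proof. by move=> sBA dA C sCB; apply: dA; apply: subset_trans sCB sBA. Qed.

(** Greedy choice: put a vertex of low degree into [I] and delete its closed neighbourhood. Each
    choice costs at most [k.+1] vertices of [A]. *)
Lemma degenerate_independent k A : degenerate k A ->
  exists I, [/\ I \subset A, independent I & #|A| <= k.+1 * #|I|].
Proof.
have [m] := ubnP #|A|; elim: m A => // m IHm A /ltnSE leAm dA.
have [->|A0] := eqVneq A set0.
  by exists set0; split; rewrite ?sub0set ?cards0 // => x y; rewrite inE.
have [x xA dx] := dA A (subxx _) A0.
set B := A :\: (x |: N x).
have sBA : B \subset A by exact: subsetDl.
have ltBA : #|B| < #|A|.
  apply: proper_card; apply/properP; split=> //.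
  by exists x => //; rewrite !inE eqxx.
have [I [sIB iI cI]] := IHm B (leq_trans ltBA leAm) (sub_degenerate sBA dA).
have IN y : y \in I -> (y == x = false) * (e x y = false).
  move=> /(subsetP sIB); rewrite !inE negb_or => /andP[/andP[/negbTE-> /negbTE->] _].
  by [].
exists (x |: I); split.
- by rewrite subUset sub1set xA (subset_trans sIB).
- move=> y z /setU1P[->|yI] /setU1P[->|zI].
  + by rewrite eirr.
  + by rewrite IN.
  + by rewrite esym IN.
  + exact: iI.
- have xI : x \notin I by apply/negP => /IN[]; rewrite eqxx.
  have : #|A :&: (x |: N x)| <= k.+1.
    rewrite setIUr (leq_trans (leq_card_setU _ _)) // -add1n leq_add //.
      by rewrite (leq_trans (subset_leq_card (subsetIr _ _))) ?cards1.
    by rewrite setIC.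
  have := cardsID (x |: N x) A; rewrite -/B cardsU1 xI /= mulnDr muln1.
  lia.
Qed.

(** Deleting a vertex with at most [k] neighbours in [A] lowers the sum by at most [2 * k], since
    each lost edge is counted at both ends. The inequality is strict because the last remaining
    vertex contributes 0. *)
Lemma degenerate_degree_sum k A : 0 < k -> degenerate k A -> A != set0 ->
  \sum_(x in A) #|N x :&: A| < 2 * k * #|A|.
Proof.
move=> k0; have [m] := ubnP #|A|; elim: m A => // m IHm A /ltnSE leAm dA A0.
have [x xA dx] := dA A (subxx _) A0.
set B := A :\ x.
have cA : #|A| = #|B|.+1 by rewrite (cardsD1 x) xA.
have NxB : N x :&: A = N x :&: B.
  apply/setP => y; rewrite !inE; case: eqVneq => // ->; by rewrite eirr.
have sumE : \sum_(y in A) #|N y :&: A| =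
    #|N x :&: B| + (\sum_(y in B) #|N y :&: B| + #|N x :&: B|).
  rewrite (big_setD1 x) //= NxB; congr (_ + _).
  have -> : #|N x :&: B| = \sum_(y in B) (y \in N x).
    rewrite -sum1_card big_mkcond [RHS]big_mkcond; apply: eq_bigr => y _.
    by rewrite inE andbC; case: (y \in B); case: (y \in N x).
  rewrite -big_split; apply: eq_bigr => y _.
  by rewrite [#|N y :&: A|](cardsD1 x) !inE esym xA andbT addnC setIDA.
have [B0|B0] := eqVneq B set0.
  by rewrite sumE B0 setI0 big_set0 !cards0 muln_gt0 muln_gt0 k0 cA.
have := IHm B _ (sub_degenerate (subsetDl _ _) dA) B0; rewrite -cA => /(_ leAm).
move: dx; rewrite sumE cA NxB; nia.
Qed.

(** All [k] neighbours of a vertex of [I] lie outside [I], so [~: I] is dominating and [k]-fair. *)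
Lemma fd_independent k I : 0 < k -> independent I ->
  {in I, forall v, degree v = k} -> fd e + #|I| <= #|T|.
Proof.
move=> k0 iI dI; suff fdI : fd_set e (~: I).
  by have [_ /(_ _ fdI)] := fdP e; have := cardsC I; lia.
have cI v : v \in I -> N v :&: ~: I = N v.
  move=> vI; apply/setIidPl/subsetP => u; rewrite !inE => evu.
  by apply/negP => /(iI _ _ vI); rewrite evu.
apply/fd_setP; exists k => //; apply/andP; split; apply/forallP => v.
  rewrite inE; have [vI /=|//] := boolP (v \in I).
  have : 0 < #|N v :&: ~: I| by rewrite cI // -/(degree v) dI.
  by case/card_gt0P => u /setIP[]; rewrite inE => evu uI; apply/existsP; exists u; rewrite uI.
by apply/implyP; rewrite inE negbK => vI; rewrite cI // -/(degree v) dI.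
Qed.

Lemma fd_degenerate k j A : 0 < k -> degenerate j A ->
  {in A, forall v, degree v = k} -> 17 * #|T| <= 19 * fd e ->
  19 * #|A| <= 2 * j.+1 * #|T|.
Proof.
move=> k0 dA degA fdT; have [I [sIA iI cI]] := degenerate_independent dA.
have : fd e + #|I| <= #|T|.
  by apply: (fd_independent k0 iI) => v /(subsetP sIA); apply: degA.
nia.
Qed.

End Degeneracy.

(** * Subsequences and cyclic successors *)

Section Polygon.
Variable T : eqType.
Implicit Types (x y : T) (c s t : seq T).

Lemma subseq_rcons_inv c s x : subseq c (rcons s x) ->
  subseq c s \/ exists2 c', c = rcons c' x & subseq c' s.
Proof.
case/subseqP => m; rewrite size_rcons; case/lastP: m => // m b.
rewrite size_rcons => -[sz] ->; rewrite mask_rcons //; case: b => /=.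
  by right; exists (mask m s); rewrite ?cats1 ?mask_subseq.
by left; rewrite cats0 mask_subseq.
Qed.

Lemma next_cat_cons c1 x y c2 : uniq (c1 ++ x :: y :: c2) ->
  next (c1 ++ x :: y :: c2) x = y.
Proof. by move=> u; rewrite -(next_rot (size c1)) // rot_size_cat /= eqxx. Qed.

Lemma next_last x c y : uniq (x :: rcons c y) -> next (x :: rcons c y) y = x.
Proof.
rewrite -rcons_cons -cats1 => u.
by rewrite -(next_rot (size (x :: c))) // rot_size_cat /= eqxx.
Qed.

(** With [i = 0] this turns inequalities between positions into the subsequence hypothesis of
    [non_crossing]; the general offset serves the induction. *)
Lemma subseq_drop_index c s i : all (fun x => i <= index x s) c ->
  {subset c <= s} -> sorted (relpre (index^~ s) ltn) c -> subseq c (drop i s).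
Proof.
elim: c i => [|x c IHc] i /=; first by rewrite sub0seq.
case/andP=> ix _ sub xc.
have xs : x \in s by apply: sub; rewrite mem_head.
have -> : drop i s = take (index x s - i) (drop i s) ++ drop (index x s) s.
  by rewrite -[LHS](cat_take_drop (index x s - i)) drop_drop subnK.
apply: subseq_trans (suffix_subseq _ _).
rewrite (drop_nth x) ?index_mem // nth_index //= eqxx.
apply: IHc => [|y yc|].
- apply: order_path_min xc => a b d /=; exact: ltn_trans.
- by apply: sub; rewrite inE yc orbT.
- exact: path_sorted xc.
Qed.

End Polygon.

(** * Degeneracy, rotations and triangles in polygon triangulations *)

Section Triangulation.
Variables (T : finType) (e : rel T).
Hypotheses (esym : symmetric e) (eirr : irreflexive e).
Implicit Types (x y v w : T) (c s t : seq T).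

Local Notation N := (neighborhood e).
Local Notation triangulation := (polygon_triangulation e).

(* Any vertex of B strictly below a shortest chord of B having vertices of B
   below it is joined, within B, to its two neighbours in cyclic order only. *)
Lemma non_crossing_degenerate s : (forall x, x \in s) -> non_crossing e s ->
  degenerate e 2 setT.
Proof.
move=> sT ncr B _ B0; pose pos x := index x s.
have pos_inj : injective pos by move=> x y; apply: index_inj.
pose between x y z := pos x < pos z < pos y.
have [x xB xP] : exists2 x, x \in B & forall y z, y \in B -> z \in B -> e x y ->
    (between x y z = false) * (between y x z = false).
  (* A chord is an edge inside [B], listed by increasing position, with a vertex of [B] strictly
     between its ends. If there is none, any vertex of [B] serves as [x]. *)
  pose chord (p : T * T) := [&& p.1 \in B, p.2 \in B, e p.1 p.2
    & [exists z in B, between p.1 p.2 z]].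
  case: (pickP chord) => [p0 chord0|nochord]; last first.
    have [x xB] := set0Pn _ B0; exists x => // y z yB zB exy.
    split; apply/negbTE/negP => zP; [have := nochord (x, y)|have := nochord (y, x)];
      rewrite /chord /= xB yB ?exy 1?esym ?exy /= => /existsP; case; by exists z; rewrite zB.
  case: (arg_minnP (fun p => pos p.2 - pos p.1) chord0) => -[a b] /=.
  case/and4P => /= aB bB eab /exists_inP[x xB /andP[ax xb]] minab; exists x => //.
  (* An edge from [x] to a vertex beyond [a] or [b] would cross [a b]. *)
  have inside y : y \in B -> e x y -> pos a <= pos y <= pos b.
    move=> yB exy; rewrite leqNgt [X in _ && X]leqNgt -negb_or; apply/negP; case/orP => lt.
      apply: (ncr y a x b); last by rewrite esym.
      rewrite -[s]drop0; apply: subseq_drop_index => //=.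
      by rewrite -!/(pos _) lt ax xb.
    apply: (ncr a x b y); last by [].
    rewrite -[s]drop0; apply: subseq_drop_index => //=.
    by rewrite -!/(pos _) lt ax xb.
  move=> y z yB zB exy; have /andP[ay yb] := inside y yB exy.
  split; apply/negbTE/negP => zP.
    (* The edge [x y] would be a chord strictly shorter than [a b]. *)
    have := minab (x, y); rewrite /chord /= xB yB exy /=.
    have -> : [exists z in B, between x y z] by apply/existsP; exists z; rewrite zB.
    by move: zP => /andP[xz zy] /(_ isT) /=; lia.
  have := minab (y, x); rewrite /chord /= xB yB esym exy /=.
  have -> : [exists z in B, between y x z] by apply/existsP; exists z; rewrite zB.
  by move: zP => /andP[xz zy] /(_ isT) /=; lia.
exists x => //.
(* Each side of [x] holds at most one neighbour in [B]: of two, the nearer would lie strictly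
   between [x] and the farther. *)
have cover : N x :&: B \subset
    [set y in N x :&: B | pos y < pos x] :|: [set y in N x :&: B | pos x < pos y].
  apply/subsetP => y; rewrite !inE => /andP[exy ->]; rewrite exy /=.
  case: ltngtP => // /pos_inj yx; by rewrite yx eirr in exy.
apply: leq_trans (subset_leq_card cover) _.
apply: leq_trans (leq_card_setU _ _) _; rewrite -[2]/(1 + 1).
apply: leq_add; apply/card_le1_eqP => y z; rewrite !inE;
  move=> /andP[/andP[exy yB] xy] /andP[/andP[exz zB] xz]; apply: pos_inj;
  have [] := xP _ _ yB zB exy; have [] := xP _ _ zB yB exz; rewrite /between; lia.
Qed.

(** A subsequence of [rcons t x] either lies in [t] or ends in [x]. In the second case moving [x] to
    the front gives a subsequence of [x :: t], and crossing, cycles and successors are invariant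
    under rotation. *)
Lemma triangulation_rot1 x t : triangulation (x :: t) -> triangulation (rcons t x).
Proof.
case=> -[u sT] [sz cyc] ncr face.
have rotE z : rcons z x = rot 1 (x :: z) by rewrite rot1_cons.
split.
- by split=> [|y]; rewrite rotE ?rot_uniq ?mem_rot.
- by rewrite rotE size_rot rot_cycle.
- move=> a b c d /subseq_rcons_inv[sub|[c']].
    by apply: ncr; apply: subseq_trans sub (subseq_cons _ _).
  rewrite -[[:: a; b; c; d]]/(rcons [:: a; b; c] d) => /rcons_inj[<- ->] sub [eac ebd].
  by apply: (ncr x a b c); [rewrite /= eqxx | rewrite esym].
- move=> c [/subseq_rcons_inv[sub|[c' -> sub]] szc cycc chords].
    by apply: face; split=> //; apply: subseq_trans sub (subseq_cons _ _).
  have uc : uniq (x :: c') by apply: subseq_uniq u; rewrite /= eqxx.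
  move: szc cycc chords; rewrite rotE size_rot rot_cycle => szc cycc chords.
  apply: face; split=> //=; first by rewrite eqxx.
  move=> y z yc zc eyz; have := chords y z; rewrite !mem_rot !next_rot //; exact.
Qed.

Lemma triangulation_rot k s : triangulation s -> triangulation (rot k s).
Proof.
move=> tri; elim: k => [|k IHk]; first by rewrite rot0.
have [ltk|lek] := ltnP k (size s); last first.
  by rewrite rot_oversize // (leq_trans lek).
rewrite rotS //; case: (rot k s) IHk => // x t; rewrite rot1_cons.
exact: triangulation_rot1.
Qed.

(* A shortest cycle of the form v, q, c with c a subsequence of r has no chord,
   so it bounds a face. *)
Lemma triangle_on_first_side v q r : triangulation [:: v, q & r] ->
  exists w, e v w && e q w.
Proof.
case=> -[u sT] [sz cyc] ncr face.
suff H c : subseq c r -> c != [::] -> path e q (rcons c v) ->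
    exists w, e v w && e q w.
  by apply: (H r) => //; [case: (r) sz|case/andP: cyc].
have [m] := ubnP (size c); elim: m c => // m IHm c /ltnSE lem sub c0 pc.
have eqv : e v q by case/andP: cyc.
case: c => [//|w [|w' c']] in lem sub c0 pc *.
  by exists w; move: pc => /= /and3P[-> ewv _]; rewrite esym ewv.
move: (w :: w' :: c') (isT : 1 < size (w :: w' :: c')) => c c2 in lem sub c0 pc *.
pose f := [:: v, q & c].
have subf : subseq f [:: v, q & r] by rewrite /= !eqxx.
have uf : uniq f by exact: subseq_uniq u.
have [x [y [xy exy yf nxy nyx]]] : exists x y,
    [/\ index x f < index y f, e x y, y \in f, y != next f x & x != next f y].
  (* Without a chord [f] would be a face, hence have three corners, whereas it has at least four. *)
  have : ~~ [forall x in f, forall y in f, e x y ==> (y == next f x) || (x == next f y)].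
    apply/negP => /forall_inP chords; suff szf : size f = 3.
      by rewrite -[c]/(behead (behead f)) !size_behead szf in c2.
    apply: face; split; [exact: subf|exact: ltnW c2|by rewrite /f /= eqv|].
    by move=> x y /chords/forall_inP xf /xf/implyP xy /xy/orP[]/eqP; [left|right].
  case/forall_inPn => x xf /forall_inPn[y yf]; rewrite negb_imply negb_or.
  case/and3P=> exy nxy nyx; case: (ltngtP (index x f) (index y f)) => [lt|lt|].
  - by exists x, y.
  - by exists y, x; rewrite esym.
  - by move=> /(index_inj x xf yf) xy; rewrite xy eirr in exy.
have xf : x \in f by rewrite -index_mem (ltn_trans xy) ?index_mem.
have [f1 [f2 [f3 ff]]] : exists f1 f2 f3, f = f1 ++ x :: f2 ++ y :: f3.
  case/splitPr: xf => f1 f2 in xy yf uf *.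
  suff /splitPr[f3 f4] : y \in f2 by exists f1, f3, f4.
  move: yf; rewrite mem_cat in_cons => /or3P[yf1|/eqP yx|//].
    have xf1 : x \notin f1.
      by move: uf; rewrite -cat_rcons cat_uniq rcons_uniq => /and3P[/andP[]].
    by move: xy; rewrite !index_cat yf1 (negbTE xf1) /= eqxx addn0 ltnNge ltnW ?index_mem.
  by rewrite yx eirr in exy.
have f20 : f2 != [::].
  by apply: contraNneq nxy => f20; rewrite ff f20 in uf *; rewrite next_cat_cons.
have f130 : (f1 != [::]) || (f3 != [::]).
  rewrite -negb_and; apply: contra nyx => /andP[/eqP f10 /eqP f30].
  by move: uf; rewrite ff f10 f30 cat0s cats1 => uf; rewrite next_last.
(* The chord [x y] splits the cycle [f]; induction continues with the part containing the side
   [v q]. The cases are [x = v], where [f3] is cut off, then [x = q] and both ends in [c], where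
   [f2] is cut off. *)
case: f1 => [|a [|b f1]] in ff f130 *.
- case: f2 => [//|b c1] in ff f20 *; case: ff => vx _ cE.
  case: f3 => [//|z f3] in cE f130 *; move: lem sub pc; rewrite cE => lem sub pc.
  apply: (IHm (rcons c1 y)).
  + by move: lem; rewrite size_rcons size_cat /=; clear; lia.
  + by apply: subseq_trans sub; rewrite -cats1 subseq_cat2l /= eqxx.
  + by case: (c1).
  move: pc; rewrite rcons_cat cat_path /= => /andP[pc1 /andP[ey _]].
  by rewrite !rcons_path pc1 ey last_rcons esym vx.
- case: ff => _ qx cE; move: lem sub pc; rewrite cE => lem sub pc.
  apply: (IHm (y :: f3)) => //.
  + by move: lem; rewrite size_cat /=; case: (f2) f20 => //= ? ? _; clear; lia.
  + by apply: subseq_trans sub; exact: suffix_subseq.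
  + by move: pc; rewrite rcons_cat cat_path /= qx exy => /and3P[].
- case: ff => _ _ cE; move: lem sub pc; rewrite cE => lem sub pc.
  apply: (IHm (f1 ++ x :: y :: f3)).
  + by move: lem; rewrite !size_cat /= size_cat /=; case: (f2) f20 => //= ? ? _; clear; lia.
  + by apply: subseq_trans sub; rewrite subseq_cat2l /= eqxx; exact: suffix_subseq.
  + by case: (f1).
  + move: pc; rewrite !rcons_cat !cat_path /= rcons_cat cat_path /= exy.
    by case/and4P=> -> -> _ /andP[].
Qed.


(** * The outer cycle and the vertices of degree 2 and 3 *)

Section Next.
Variable s : seq T.
Hypothesis tri : triangulation s.

Local Notation nx := (next s).
Local Notation pv := (prev s).

Let us : uniq s. Proof. by case: tri => -[]. Qed.
Let sT x : x \in s. Proof. by case: tri => -[]. Qed.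

Lemma rotate_to x : exists k y t,
  [/\ rot k s = [:: x, y & t], triangulation [:: x, y & t] & y = nx x].
Proof.
have [k t kt] := rot_to (sT x).
have := triangulation_rot k tri; rewrite kt => trik.
case: t => [|y t] in kt trik *; first by case: trik => _ [].
by exists k, y, t; split=> //; rewrite -(next_rot k us) kt /= eqxx.
Qed.

Lemma edge_next x : e x (nx x).
Proof. by case: tri => _ [_ cyc] _ _; apply: next_cycle. Qed.

(** The successor map is a single cycle through all vertices. Closed sets that are too small
    therefore contradict the bounds on [#|T|]. *)
Lemma next_closed (A : {set T}) x : x \in A -> {in A, forall y, nx y \in A} ->
  A = setT.
Proof.
move=> xA closed; apply/setP => y; rewrite inE.
have [k t kt] := rot_to (sT x).
have := cycle_next us; rewrite -(rot_cycle k) kt /= => pt.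
have : y \in x :: t by rewrite -kt mem_rot.
rewrite inE => /predU1P[-> //|yt].
have {yt} : y \in rcons t x by rewrite mem_rcons inE yt orbT.
move: (rcons t x) pt => {kt t} l; elim: l x xA => [|z u IHu] w wA //= /andP[/eqP nw pu].
by rewrite inE => /predU1P[->|]; [rewrite -nw closed|apply: (IHu z); rewrite -?nw ?closed // nw].
Qed.

Lemma triangle_on_side x : exists w, e x w && e (nx x) w.
Proof.
have [k [y [t [_ trit <-]]]] := rotate_to x.
exact: triangle_on_first_side trit.
Qed.

(** The edge from [x] to [nx (nx x)] cuts off [nx x]; any other edge at [nx x] would cross it. *)
Lemma ear_neighbor x d : e x (nx (nx x)) -> e (nx x) d -> d = x \/ d = nx (nx x).
Proof.
have [k [y [t [kt trit yx]]]] := rotate_to x; rewrite -yx.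
case: (trit) => -[ut tT] [szt _] ncr _.
case: t => [//|z t] in kt trit yx ut tT ncr szt *.
have -> : nx y = z.
  by rewrite -(next_rot k us) kt (@next_cat_cons _ [:: x] y z t) // -kt rot_uniq.
move=> exz eyd; have := tT d; rewrite !inE => /or4P[/eqP->|/eqP dy|/eqP->|dt].
- by left.
- by rewrite dy eirr in eyd.
- by right.
- by case: (ncr x y z d); rewrite //= !eqxx sub1seq.
Qed.

Hypothesis card4 : 3 < #|T|.

Lemma next_neq x : nx x != x.
Proof. by apply/eqP => E; have := edge_next x; rewrite E eirr. Qed.

Lemma next2_neq x : nx (nx x) != x.
Proof.
apply/eqP => E; have : [set x; nx x] = setT.
  by apply: (@next_closed _ x) => [|y]; rewrite !inE ?eqxx // => /orP[]/eqP->; rewrite ?E eqxx ?orbT.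
by move=> /(congr1 (fun A : {set T} => #|A|)) cT; move: card4; rewrite -[#|T|]cardsT -cT cards2; case: eqP.
Qed.

Lemma next3_neq x : nx (nx (nx x)) != x.
Proof.
apply/eqP => E; have : [set x; nx x; nx (nx x)] = setT.
  apply: (@next_closed _ x) => [|y]; rewrite !inE ?eqxx // -orbA.
  by case/or3P => /eqP->; rewrite ?E eqxx ?orbT.
move/(congr1 (fun A : {set T} => #|A|)) => cT.
move: card4; rewrite -[#|T|]cardsT -cT ltnNge => /negP[].
have [+ _] := leq_card_setU [set x; nx x] [set nx (nx x)].
by move/leq_trans; apply; rewrite cards1 cards2; case: eqP.
Qed.

Lemma sub_neighbors x : [set x; nx (nx x)] \subset N (nx x).
Proof. by apply/subsetP => y; rewrite !inE => /orP[]/eqP->; rewrite ?edge_next // esym edge_next. Qed.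

Lemma next_prev_cancel x : nx (pv x) = x.
Proof. by rewrite next_prev. Qed.

Lemma degree_ge2 x : 2 <= degree e x.
Proof.
rewrite -(next_prev_cancel x); have := subset_leq_card (sub_neighbors (pv x)).
by rewrite cards2 eq_sym next2_neq.
Qed.

Lemma degree2_neighbors x : degree e (nx x) = 2 -> N (nx x) = [set x; nx (nx x)].
Proof.
move=> d2; apply/eqP; rewrite eq_sym eqEcard sub_neighbors -/(degree e _) d2.
by rewrite cards2 eq_sym next2_neq.
Qed.

Lemma degree3_neighbors x u : degree e (nx x) = 3 -> e (nx x) u ->
  u != x -> u != nx (nx x) -> N (nx x) = [set x; nx (nx x); u].
Proof.
move=> d3 eu ux unx; apply/eqP; rewrite eq_sym eqEcard -/(degree e _) d3.
rewrite subUset sub_neighbors sub1set inE eu /= setUC cardsU1 !inE negb_or ux unx.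
by rewrite cards2 eq_sym next2_neq.
Qed.

(** A vertex of degree 2 sees only its predecessor and successor, so two adjacent ones span a side.
    The apex of the triangle on that side would be an outer neighbour of both ends, which forces a
    cycle of length at most 3. *)
Lemma degree2_independent : independent e [set v | degree e v == 2].
Proof.
suff H v : degree e v = 2 -> degree e (nx v) <> 2.
  move=> u v; rewrite !inE => /eqP du /eqP dv; apply/negP => euv.
  have : v \in N u by rewrite inE.
  rewrite -(next_prev_cancel u) in du *; rewrite degree2_neighbors // !inE.
  by case/orP=> /eqP vE; [apply: (H v); rewrite // vE|apply: (H _ du); rewrite -vE].
rewrite -(next_prev_cancel v); move: (pv v) => p dv dq.
have [w /andP[]] := triangle_on_side (nx p).
have E y : e y w = (w \in N y) by rewrite inE.
rewrite !E !degree2_neighbors // !inE => /orP[]/eqP->.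
  by rewrite ![p == _]eq_sym (negbTE (next_neq _)) (negbTE (next3_neq _)).
by rewrite (negbTE (next_neq _)) eq_sym (negbTE (next_neq _)).
Qed.

Hypothesis card5 : 4 < #|T|.

(** If [u] is not next to [v] on the cycle, the triangles on both sides at [v] have apex [u]. So [u]
    is adjacent to [v] and to both cyclic neighbours of [v], and degree 3 leaves room only for a
    4-cycle. *)
Lemma degree3_adjacent v u : degree e v = 3 -> degree e u = 3 -> e v u ->
  u = nx v \/ v = nx u.
Proof.
rewrite -(next_prev_cancel v); move: (pv v) => p dv du evu.
have [->|uq] := eqVneq u (nx (nx p)); first by left.
have [->|up] := eqVneq u p; first by right.
have Nv := degree3_neighbors dv evu up uq.
have inN y w : e y w = (w \in N y) by rewrite inE.
have not_ear : ~ e p (nx (nx p)).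
  by move=> epq; case: (ear_neighbor epq evu); [exact/eqP|exact/eqP].
have epu : e p u.
  have [w /andP[epw]] := triangle_on_side p.
  rewrite inN Nv !inE -orbA => /or3P[] /eqP wE; rewrite wE ?eirr // in epw *.
have equ : e (nx (nx p)) u.
  have [w /andP[]] := triangle_on_side (nx p).
  rewrite inN Nv !inE -orbA => /or3P[] /eqP-> // eq_.
    by case: not_ear; rewrite esym.
  by rewrite eirr in eq_.
have uv : u != nx p by apply: contraTneq evu => ->; rewrite eirr.
move: uq up uv du evu epu equ; clear Nv; rewrite -(next_prev_cancel u).
move: (pv u) => r uq up uv du evu epu equ.
have vr : nx p != r by apply: contraNneq uq => ->.
have vnu : nx p != nx (nx r).
  by apply: contraNneq up => /(can_inj (prev_next us))->.
have Nu : N (nx r) = [set r; nx (nx r); nx p].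
  by apply: degree3_neighbors; rewrite // esym.
have pE : p = nx (nx r).
  have : p \in N (nx r) by rewrite inE esym.
  rewrite Nu !inE -orbA => /or3P[/eqP pr|/eqP//|].
    by rewrite pr eqxx in uv.
  by rewrite eq_sym (negbTE (next_neq _)).
have qE : nx (nx p) = r.
  have : nx (nx p) \in N (nx r) by rewrite inE esym.
  rewrite Nu !inE -orbA => /or3P[/eqP//||]; last by rewrite (negbTE (next_neq _)).
  by rewrite -pE (negbTE (next2_neq _)).
(* Here [p], [nx p], [r], [nx r] close up under [next], giving at most four vertices. *)
exfalso; have : [set p; nx p] :|: [set r; nx r] = setT.
  apply: (@next_closed _ p) => [|y]; rewrite !inE ?eqxx // -orbA.
  by case/or4P => /eqP->; rewrite -?pE ?qE eqxx ?orbT.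
move/(congr1 (fun A : {set T} => #|A|)) => cT.
move: card5; rewrite -[#|T|]cardsT -cT ltnNge => /negP[].
have [+ _] := leq_card_setU [set p; nx p] [set r; nx r].
by move/leq_trans; apply; rewrite !cards2; do 2 case: eqP.
Qed.

(** If [x] ends a run of [B] along the cycle, its only possible neighbour in [B] is [pv x]. Such an
    end exists: otherwise every vertex would have degree 3, against 2-degeneracy. *)
Lemma degree3_degenerate : degenerate e 1 [set v | degree e v == 3].
Proof.
move=> B sB B0; have [z zB] := set0Pn _ B0.
have [x xB nxB] : exists2 x, x \in B & nx x \notin B.
  apply/exists_inP; rewrite -[X in is_true X]negbK negb_exists_in.
  apply/negP => /forall_inP closed; have BT : B = setT.
    by apply: (next_closed zB) => y /closed; rewrite negbK.
  have [_ _ ncr _] := tri.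
  have [y yB] := non_crossing_degenerate sT ncr (subsetT B) B0.
  by rewrite BT setIT; have := subsetP sB y yB; rewrite inE => /eqP; rewrite /degree => ->.
exists x => //; apply/card_le1_eqP => y y'.
have E w : w \in N x :&: B -> w = pv x.
  rewrite !inE => /andP[exw wB].
  have dx := subsetP sB x xB; have dw := subsetP sB w wB; rewrite !inE in dx dw.
  case: (degree3_adjacent (eqP dx) (eqP dw) exw) => [wE|->].
    by rewrite -wE wB in nxB.
  by rewrite prev_next.
by move=> /E-> /E->.
Qed.

End Next.

End Triangulation.

(** * The degree count and the bound *)

Lemma maximal_outerplanar_fd (T : finType) (e : rel T) :
  maximal_outerplanar e -> 19 * fd e < 17 * #|T|.
Proof.
case=> esym eirr [s tri]; have [[us sT] [sz _] ncr _] := tri.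
have degP k j : 0 < k -> degenerate e j [set v | degree e v == k] ->
    17 * #|T| <= 19 * fd e -> 19 * #|[set v | degree e v == k]| <= 2 * j.+1 * #|T|.
  move=> k0 dj; apply: (fd_degenerate esym eirr k0 dj) => v.
  by rewrite inE => /eqP.
have deg2 : degenerate e 2 setT := non_crossing_degenerate esym eirr sT ncr.
have cardT : #|T| = size s.
  by rewrite -(card_uniqP us); apply: eq_card => x; rewrite sT.
have x : T by case: (s) sz.
(* For at most four vertices, the complement of one vertex suffices: [19 * (n - 1) < 17 * n] for
   small [n]. *)
have [card5|] := ltnP 4 #|T|; last first.
  have eI : independent e [set x] by move=> y z /set1P-> /set1P->; rewrite eirr.
  have d0 : 0 < degree e x by apply/card_gt0P; exists (next s x); rewrite inE (edge_next tri).
  have := fd_independent d0 eI; rewrite cards1 => /(_ (fun v vx => congr1 _ (set1P vx))).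
  by rewrite cardT; lia.
have card4 : 3 < #|T| by apply: ltnW.
rewrite ltnNge; apply/negP => fdT.
have indep0 : degenerate e 0 [set v | degree e v == 2].
  move=> B sB /set0Pn[y yB]; exists y => //; rewrite leqn0 cards_eq0; apply/eqP/setP => z.
  rewrite !inE; apply/negbTE/negP => /andP[eyz zB].
  by have := degree2_independent esym eirr tri card4 (subsetP sB y yB) (subsetP sB z zB); rewrite eyz.
have c2 := degP 2 0 isT indep0 fdT.
have c3 := degP 3 1 isT (degree3_degenerate esym eirr tri card4 card5) fdT.
have c4 := degP 4 2 isT (sub_degenerate (subsetT _) deg2) fdT.
have c5 := degP 5 2 isT (sub_degenerate (subsetT _) deg2) fdT.
have sumT : \sum_x degree e x < 4 * #|T|.
  have T0 : [set: T] != set0 by apply/set0Pn; exists x.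
  have := degenerate_degree_sum esym eirr (ltn0Sn 1) deg2 T0.
  by rewrite cardsT big_mkcond /=; under eq_bigr do rewrite inE setIT.
have cE k m : \sum_v m * (degree e v == k) = m * #|[set v | degree e v == k]|.
  rewrite -sum1_card big_distrr /= [RHS]big_mkcond; apply: eq_bigr => v _.
  by rewrite inE; case: eqP; rewrite ?muln0.
(* The weight for degree [d] is [6 - d], which lifts every summand to at least 6; degrees 0 and 1
   are excluded by [degree_ge2]. *)
have : 6 * #|T| <= \sum_v (degree e v + 4 * (degree e v == 2) + 3 * (degree e v == 3)
    + 2 * (degree e v == 4) + 1 * (degree e v == 5)).
  rewrite mulnC -sum_nat_const; apply: leq_sum => v _.
  have := degree_ge2 esym tri card4 v.
  by case: (degree e v) => [|[|[|[|[|[|d]]]]]].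
rewrite 4!big_split /= !cE.
move: (\sum_x degree e x) sumT => S; move: #|[set v | _]| c2 => n2.
move: #|[set v | _]| c3 => n3.
move: #|[set v | _]| c4 => n4.
move: #|[set v | _]| c5 => n5.
move: #|T| => n; clear; lia.
Qed.

Theorem theorem5 (T : finType) (e : rel T) (n : nat)
    (hn : (3 <= n)%N) (cardT : #|T| = n) (hG : maximal_outerplanar e) :
  ((fd e)%:R < 17%:R * n%:R / 19%:R :> rat)%R.
Proof.
rewrite Num.Theory.ltr_pdivlMr ?Num.Theory.ltr0n // -!GRing.natrM Num.Theory.ltr_nat mulnC -cardT.
exact: maximal_outerplanar_fd.
Qed.
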